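(* Let $n\ge 2$ and $\mathbf{y}=(y_1,y_2,\dots,y_n)\in\mathbb{N}^n$. Then $\chi(\mathbf{y})=n-1$ if and only if $$y_1\ge y_2\quad\text{and}\quad y_2=y_3=\cdots=y_n.$$
   Context: $\mathbb{N}=\{1,2,3,\dots\}$ and $[n]=\{1,\dots,n\}$. Let $\mathbf{y}=(y_1,\dots,y_n)\in\mathbb{N}^n$ and $m=\sum_{i=1}^n y_i$. Consider a one-way street with $m$ parking spots numbered $1,\dots,m$ and $n$ cars entering in order $1,2,\dots,n$, where car $i$ has length $y_i$ and prefers spot $x_i\in[m]$. Car $i$ drives to spot $x_i$ and parks in $x_i,x_i+1,\dots,x_i+y_i-1$ if these spots exist and are all unoccupied; otherwise it parks in the next $y_i$ contiguous available spots, i.e. it occupies $s,s+1,\dots,s+y_i-1$ for the smallest $s\ge x_i$ such that $s+y_i-1\le m$ and all these spots are unoccupied; if no such $s$ exists, parking fails. The vector $\mathbf{x}=(x_1,\dots,x_n)\in[m]^n$ is a parking assortment for $\mathbf{y}$ if all cars can park; the set of these is $\mathsf{PA}_n(\mathbf{y})$. A parking assortment $\mathbf{x}$ is (permutation) invariant if every permutation of its entries is also in $\mathsf{PA}_n(\mathbf{y})$; $\mathsf{PA}^{\mathrm{inv}}_n(\mathbf{y})$ is the set of invariant parking assortments for $\mathbf{y}$. For $\mathbf{x}\in\mathsf{PA}^{\mathrm{inv}}_n(\mathbf{y})$ the degree is $\deg\mathbf{x}=|\{i\in[n]:x_i\ne 1\}|$, and the characteristic of $\mathbf{y}$ is $\chi(\mathbf{y})=\max_{\mathbf{z}\in\mathsf{PA}^{\mathrm{inv}}_n(\mathbf{y})}\deg\mathbf{z}$.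 *)

(* Defs.v *)
From mathcomp Require Import all_boot.

Set Implicit Arguments.
Unset Strict Implicit.
Unset Printing Implicit Defensive.

(* Spots carry their own number 1, ..., m.  Tuples are indexed from 0, so that
   y_i is [nth 0 y i.-1]. *)

Definition street_length (n : nat) (y : n.-tuple nat) : nat :=
  \sum_(i < n) tnth y i.

(* [s + l <= m.+1] is s + l - 1 <= m without truncated subtraction. *)
Definition fits (m : nat) (occ : seq nat) (l s : nat) : bool :=
  (s + l <= m.+1) && all (fun j => j \notin occ) (iota s l).

(* The least s in {x, ..., m} at which the car fits.  This includes s = x, so
   it also covers a car that parks at its preferred spot. *)
Definition parking_spot (m : nat) (occ : seq nat) (x l : nat) : option nat :=
  ohead [seq s <- iota x (m.+1 - x) | fits m occ l s].

(* Cars are pairs (preference, length), in order of arrival. *)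
Fixpoint all_park (m : nat) (occ : seq nat) (cars : seq (nat * nat)) : bool :=
  if cars is (x, l) :: cars' then
    if parking_spot m occ x l is Some s
    then all_park m (iota s l ++ occ) cars'
    else false
  else true.

(* An element of [m]^n is a tuple over 'I_m.+1 = {0, ..., m} with positive
   entries; positivity is imposed in [PA]. *)
Definition preferences (n : nat) (y : n.-tuple nat) : finType :=
  n.-tuple 'I_(street_length y).+1.

Definition PA (n : nat) (y : n.-tuple nat) : {set preferences y} :=
  [set x : preferences y |
    [forall i, 0 < tnth x i]
    && all_park (street_length y) [::] (zip (map val x) y)].

Definition PAinv (n : nat) (y : n.-tuple nat) : {set preferences y} :=
  [set x in PA y |
    [forall x' : preferences y, perm_eq x' x ==> (x' \in PA y)]].

Definition deg (n : nat) (y : n.-tuple nat) (x : preferences y) : nat :=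
  #|[set i | (tnth x i : nat) != 1]|.

(* \max over an empty set would be 0, but for positive lengths (1, ..., 1) is
   always an invariant parking assortment. *)
Definition chi (n : nat) (y : n.-tuple nat) : nat :=
  \max_(z in PAinv y) deg z.

(* Main.v *)
Require Import Defs.
From mathcomp Require Import all_boot.
From mathcomp Require Import zify.

(** All spots get filled, and a car preferring a spot beyond [k] parks beyond
    [k], so the cars preferring at most [k] must have total length at least [k].
    With [k = 1] this gives [chi y <= n.-1].

    If [1 < w] is the least preference other than 1 in an invariant assortment
    of degree [n.-1], put the unique preference 1 on car [i].  Counting with
    [k = w.-1] gives [w.-1 <= y_i].  If [i] is not the first car, let the first
    car prefer [w]: it parks exactly there, and car [i] has to fit in front of
    it, since otherwise all cars would end up beyond [w.-1]; so [y_i <= w.-1].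

    Conversely, when [y = (a, b, ..., b)] with [b <= a], the assortment
    [(1, b.+1, ..., b.+1)] is invariant: the cars preferring [b.+1] line up
    contiguously, leaving either nothing or exactly the spots [1, ..., b]. *)

Set Implicit Arguments.
Unset Strict Implicit.
Unset Printing Implicit Defensive.

(** * Characterization of the spot where a car parks *)

Lemma ohead_filter_iotaP (P : pred nat) x n s :
  ohead [seq t <- iota x n | P t] = Some s <->
  [/\ x <= s < x + n, P s & forall t, x <= t < s -> ~~ P t].
Proof.
elim: n x => [|n IHn] x /=; first by split=> // -[]; lia.
case Px: (P x) => /=.
  split=> [[<-]|[hs Ps hmin]].
    by split=> // [|t]; lia.
  have [->//|ne] := eqVneq x s.
  by have := hmin x; rewrite Px => /(_ _); lia.
rewrite IHn; split=> -[hs Ps hmin]; split=> //.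
- lia.
- by move=> t ht; have [->|ne] := eqVneq t x; [rewrite Px | apply: hmin; lia].
- have ne : s != x by apply: contraTneq Ps => ->; rewrite Px.
  lia.
- by move=> t ht; apply: hmin; lia.
Qed.

Lemma parking_spotP m occ x l s :
  parking_spot m occ x l = Some s ->
  [/\ x <= s, fits m occ l s & forall t, x <= t < s -> ~~ fits m occ l t].
Proof. by case/ohead_filter_iotaP=> hs fs hmin; split=> //; lia. Qed.

(** Since [0 < l], a car starting at [t] covers [t] itself, so an occupied [t] is ruled out as a
    start. *)
Lemma parking_spot_eq m occ x l s :
  0 < l -> x <= s -> fits m occ l s ->
  (forall t, x <= t < s -> t \in occ) -> parking_spot m occ x l = Some s.
Proof.
move=> l0 xs fs hocc; apply/ohead_filter_iotaP; split=> //.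
  by move: fs => /andP[]; lia.
move=> t /hocc t_occ; rewrite /fits negb_and; apply/orP; right.
by apply/allPn; exists t; rewrite ?mem_iota ?t_occ //; lia.
Qed.

(** * Counting occupied spots beyond [k] *)

Lemma count_uniq_le m k (occ : seq nat) :
  uniq occ -> all (leq^~ m) occ -> count (leq k.+1) occ <= m - k.
Proof.
move=> uocc hocc; rewrite -size_filter -(size_iota k.+1 (m - k)).
apply: uniq_leq_size; first exact: filter_uniq.
move=> j; rewrite mem_filter mem_iota => /andP[kj /(allP hocc)]; lia.
Qed.

(* A car of length exceeding [k] cannot fit before an occupied spot [k.+1]. *)
Lemma all_park_beyond m k (P : pred (nat * nat)) occ cars :
  uniq occ -> all (leq^~ m) occ -> all_park m occ cars ->
  (forall c, c \in cars -> P c ->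
     0 < c.1 /\ (k < c.1 \/ k < c.2 /\ k.+1 \in occ)) ->
  count (leq k.+1) occ + \sum_(c <- cars | P c) c.2 <= m - k.
Proof.
elim: cars occ => [|[x l] cars IH] occ uocc hocc /=.
  by rewrite big_nil addn0 => _ _; apply: count_uniq_le.
case E: parking_spot => [s|] // hpark hP.
have [xs /andP[sl /allP free] _] := parking_spotP E.
have dis : ~~ has (mem occ) (iota s l).
  by apply/hasPn=> j /free.
have u' : uniq (iota s l ++ occ).
  rewrite cat_uniq iota_uniq uocc andbT /=; apply/hasPn=> j j_occ.
  by apply/negP=> /free; rewrite j_occ.
have h' : all (leq^~ m) (iota s l ++ occ).
  by rewrite all_cat hocc andbT; apply/allP=> j; rewrite mem_iota; lia.
have := IH _ u' h' hpark; rewrite count_cat big_cons.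
have hP' c : c \in cars -> P c ->
    0 < c.1 /\ (k < c.1 \/ k < c.2 /\ k.+1 \in iota s l ++ occ).
  move=> c_in Pc; case: (hP c _ Pc); first by rewrite inE c_in orbT.
  by move=> c0 [|[? hk]]; split; auto; right; rewrite mem_cat hk orbT.
move=> /(_ hP'); case Pxl: (P (x, l)); last by lia.
have [/= x0 hx] := hP _ (mem_head _ _) Pxl.
suff ks : k < s.
  have -> : count (leq k.+1) (iota s l) = l; last by lia.
  rewrite -[RHS](size_iota s l); apply/eqP; rewrite -all_count.
  by apply/allP=> j; rewrite mem_iota; lia.
(* If [s <= k], then [0 < s] and [k < l] make the car cover the occupied spot [k.+1]. *)
case: hx => [|[kl k_occ]]; first lia.
rewrite ltnNge; apply/negP=> sk.
by move: (free k.+1); rewrite mem_iota k_occ => /(_ _)/negP; apply; lia.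
Qed.

Lemma sum_zip_sumn (P : pred (nat * nat)) (s t : seq nat) :
  size s = size t -> (forall c, c \in zip s t -> P c) ->
  \sum_(c <- zip s t | P c) c.2 = sumn t.
Proof.
move=> st hP; rewrite big_seq_cond (eq_bigl (fun c => c \in zip s t)).
  by rewrite -big_seq -(big_map snd xpredT id) -/unzip2 unzip2_zip ?sumnE ?st.
by move=> c; case: (boolP (c \in _)) => // /hP ->.
Qed.

Lemma mem_zip_fst (s t : seq nat) c : c \in zip s t -> c.1 \in s.
Proof.
elim: s t => [|x s IH] [|z t] //=.
by rewrite !inE => /orP[/eqP->|/IH ->]; rewrite ?eqxx ?orbT.
Qed.

(** Without a preference 1, all cars park beyond spot 1, leaving too few spots for their total
    length. *)
Lemma mem_one_all_park (s t : seq nat) :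
  size s = size t -> 0 < sumn t -> all (leq 1) s ->
  all_park (sumn t) [::] (zip s t) -> 1 \in s.
Proof.
move=> st t0 /allP s0 hpark; apply: contraLR t0 => s1.
have hP c : c \in zip s t -> 1 < c.1.
  move=> /mem_zip_fst c_s; have := s0 _ c_s; rewrite leq_eqVlt.
  by case: eqP => // e; rewrite e c_s in s1.
have := @all_park_beyond _ 1 xpredT [::] _ isT isT hpark.
rewrite sum_zip_sumn //= => H; rewrite -eqn0Ngt.
suff : 0 + sumn t <= sumn t - 1 by lia.
by apply: H => c /hP c1 _; split; [apply: ltnW | left].
Qed.

(** All other cars park beyond [k], so their total length is at most [m - k], where [m] is the sum
    of all lengths; the bound on [k] keeps this subtraction from truncating. *)
Lemma one_car_length_ge k (r1 r2 t1 t2 : seq nat) l :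
  size r1 = size t1 -> size r2 = size t2 -> k <= sumn (t1 ++ l :: t2) ->
  all (leq k.+1) (r1 ++ r2) ->
  all_park (sumn (t1 ++ l :: t2)) [::] (zip (r1 ++ 1 :: r2) (t1 ++ l :: t2)) ->
  k <= l.
Proof.
move=> s1 s2 km; rewrite all_cat => /andP[/allP h1 /allP h2] hpark.
have := @all_park_beyond _ k (fun c => k < c.1) [::] _ isT isT hpark.
rewrite zip_cat // big_cat /= big_cons /= (ltnNge k 1).
case: (posnP k) => [->//|k0].
have hP c : c \in zip r1 t1 \/ c \in zip r2 t2 -> k < c.1.
  by case=> /mem_zip_fst; [apply: h1 | apply: h2].
rewrite !sum_zip_sumn // => [|c ?|c ?]; try by apply: hP; auto.
move=> H; have {H} := H (fun c _ hc => conj (leq_ltn_trans (leq0n _) hc) (or_introl hc)).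
by move: km; rewrite sumn_cat /=; lia.
Qed.

(** The first car occupies [k.+1]. If [k < l], even the car preferring 1 parks beyond [k], and the
    full length [m] would lie in [m - k] spots. *)
Lemma one_car_length_le k (r1 r2 t1 t2 : seq nat) l0 l :
  size r1 = size t1 -> size r2 = size t2 -> 0 < k -> 0 < l0 ->
  all (leq k.+1) (r1 ++ r2) ->
  all_park (sumn (l0 :: t1 ++ l :: t2)) [::]
    (zip (k.+1 :: r1 ++ 1 :: r2) (l0 :: t1 ++ l :: t2)) ->
  l <= k.
Proof.
move=> s1 s2 k0 l00; rewrite all_cat => /andP[/allP h1 /allP h2].
set m := sumn _ => /=; case E: parking_spot => [s|] // hpark.
have [ks /andP[sl _] hmin] := parking_spotP E.
(* The street is empty, so a car that fits at [s] also fits at the smaller [k.+1]. *)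
have es : s = k.+1.
  apply/eqP; rewrite eqn_leq ks andbT leqNgt; apply/negP=> lt_ks.
  have := hmin k.+1; rewrite leqnn lt_ks => /(_ isT)/negP; apply.
  by rewrite /fits; apply/andP; split; [lia | apply/allP].
subst s; rewrite leqNgt; apply/negP=> kl.
have := @all_park_beyond _ k xpredT _ _ _ _ hpark.
rewrite cats0 iota_uniq => /(_ isT) H.
have {}H := H _ _.
have : l0 + sumn (t1 ++ l :: t2) <= m - k; last by rewrite /m /=; lia.
have <- : count (leq k.+1) (iota k.+1 l0) = l0.
  rewrite -[RHS](size_iota k.+1 l0); apply/eqP; rewrite -all_count.
  by apply/allP=> j; rewrite mem_iota; lia.
rewrite -(@sum_zip_sumn xpredT (r1 ++ 1 :: r2)) //; last by rewrite !size_cat /= s1 s2.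
apply: H; first by apply/allP=> j; rewrite mem_iota; lia.
rewrite zip_cat //= => c; rewrite mem_cat inE mem_iota => /or3P[] c_in _.
- by have kc := h1 _ (mem_zip_fst c_in); split; [exact: leq_ltn_trans kc | left].
- by rewrite (eqP c_in) /=; split=> //; right; split=> //; lia.
- by have kc := h2 _ (mem_zip_fst c_in); split; [exact: leq_ltn_trans kc | left].
Qed.

(** * Parking with preferences 1 and [b.+1] only *)

(** As [b <= r], each car slides over the occupied initial segment to [r.+1] and prolongs that
    segment by [b]. *)
Lemma all_park_tail m b k (occ : seq nat) r :
  0 < b -> occ =i iota 1 r -> b <= r -> r + k * b <= m ->
  all_park m occ (nseq k (b.+1, b)).
Proof.
move=> b0; elim: k occ r => //= k IH occ r hocc br hm.
rewrite (@parking_spot_eq _ _ _ _ r.+1) //.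
- apply: (IH _ (r + b)); try lia.
  by move=> j; rewrite mem_cat hocc !mem_iota; lia.
- apply/andP; split; first lia.
  by apply/allP=> j; rewrite hocc !mem_iota; lia.
- by move=> j; rewrite hocc mem_iota; lia.
Qed.

Lemma two_values_nseq b (xs : seq nat) :
  all [pred x | (x == 1) || (x == b)] xs -> count_mem 1 xs = 0 ->
  xs = nseq (size xs) b.
Proof.
move=> /allP hxs h0; apply/all_pred1P/allP=> x x_in /=.
by have /orP[/eqP e|//] := hxs _ x_in; move: x_in; rewrite e -has_pred1 has_count h0.
Qed.

(** Cars preferring [b.+1] prolong the occupied block to the right. The car preferring 1 fills
    exactly the gap of [b] spots, after which [all_park_tail] applies. *)
Lemma all_park_two_values m b (xs occ : seq nat) r :
  0 < b -> occ =i iota b.+1 r -> all [pred x | (x == 1) || (x == b.+1)] xs ->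
  count_mem 1 xs = 1 -> r + size xs * b <= m ->
  all_park m occ [seq (x, b) | x <- xs].
Proof.
move=> b0; elim: xs occ r => [|x xs IH] occ r hocc //= /andP[hx hxs].
case/orP: hx => /eqP->; rewrite ?eqxx => hcount hm.
  rewrite (@parking_spot_eq _ _ _ _ 1) //.
  - rewrite (two_values_nseq hxs (succn_inj hcount)) map_nseq; apply: (@all_park_tail _ _ _ _ (b + r)) => //; try lia.
    by move=> j; rewrite mem_cat hocc !mem_iota; lia.
  - apply/andP; split; first lia.
    by apply/allP=> j; rewrite hocc !mem_iota; lia.
  - by move=> j; lia.
have e1 : (b.+1 == 1) = false by lia.
rewrite (@parking_spot_eq _ _ _ _ (b.+1 + r)) //.
- apply: (IH _ (r + b)) => //; last by lia.
    by move=> j; rewrite mem_cat hocc !mem_iota; lia.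
  by rewrite e1 in hcount.
- by lia.
(* The car preferring 1 is still to come, so the bound on [m] accounts for the gap in front as
   well. *)
- have xs0 : 0 < size xs.
    by case: (xs) hcount => //; rewrite e1.
  apply/andP; split; first nia.
  by apply/allP=> j; rewrite hocc !mem_iota; lia.
- by move=> j; rewrite hocc mem_iota; lia.
Qed.

Lemma all_park_two_values_first a b (xs : seq nat) :
  0 < b <= a -> all [pred x | (x == 1) || (x == b.+1)] xs ->
  count_mem 1 xs = 1 ->
  all_park (a + (size xs).-1 * b) [::] (zip xs (a :: nseq (size xs).-1 b)).
Proof.
move=> /andP[b0 ba]; case: xs => [//|x xs] /= /andP[hx hxs] hcount.
have -> : zip xs (nseq (size xs) b) = [seq (x, b) | x <- xs].
  by elim: (xs) => //= z s ->.
(* The first car starts exactly at its preference: a second car gives [a + b <= m], while a lone car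
   must prefer 1. *)
set m := a + _; have spot p : 0 < p <= b.+1 -> (size xs = 0 -> p = 1) ->
    parking_spot m [::] p a = Some p.
  move=> hp hp1; apply: parking_spot_eq; try lia.
  apply/andP; split; last exact/allP.
  by case: (posnP (size xs)) => [/hp1|]; rewrite /m; nia.
case/orP: hx => /eqP ex; rewrite {}ex in hcount *.
  rewrite spot // (two_values_nseq hxs (succn_inj hcount)) map_nseq.
  by apply: (@all_park_tail _ _ _ _ a) => // j; rewrite cats0.
rewrite spot; [|lia|].
  apply: (@all_park_two_values _ _ _ _ a) => // [j|]; first by rewrite cats0.
  by move: hcount; rewrite eqSS; case: eqP => //; lia.
by case: (xs) hcount => //=; rewrite eqSS; case: eqP => //; lia.
Qed.

(** * From tuples to sequences; lengths forced by degree [n.-1] *)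

Lemma street_length_sumn n (y : n.-tuple nat) : street_length y = sumn y.
Proof. by rewrite /street_length sumnE big_tuple. Qed.

Lemma deg_count n (y : n.-tuple nat) (x : preferences y) :
  deg x = count (predC1 1) (map val x).
Proof.
rewrite /deg -sum1dep_card -sum1_count big_map big_mkcond [RHS]big_mkcond.
by rewrite big_tuple.
Qed.

Lemma PAinv_all_park n (y : n.-tuple nat) (x : preferences y) s :
  x \in PAinv y -> perm_eq s (map val x) ->
  all (leq 1) s && all_park (sumn y) [::] (zip s y).
Proof.
rewrite inE => /andP[_ /forallP hx] hs.
have hsize : size s == n by rewrite (perm_size hs) size_map size_tuple.
(* [inord] would send numbers out of range to 0, but the entries of [s] are those of [x], hence in
   range. *)
pose x' : preferences y := map_tuple inord (Tuple hsize).
have ex' : map val x' = s.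
  rewrite /= -map_comp -[RHS]map_id; apply/eq_in_map=> j /=.
  by rewrite (perm_mem hs) => /mapP[i _ ->]; rewrite inordK // ltn_ord.
have perm_x' : perm_eq x' x by apply: (perm_map_inj val_inj); rewrite ex'.
have /implyP/(_ perm_x') := hx x'; rewrite inE -street_length_sumn ex'.
case/andP=> /forallP pos ->; rewrite andbT -ex' all_map.
by apply/all_tnthP.
Qed.

Lemma deg_lt n (y : n.-tuple nat) (x : preferences y) :
  0 < sumn y -> x \in PAinv y -> deg x < n.
Proof.
move=> y0 hx; have /andP[pos hpark] := PAinv_all_park hx (perm_refl _).
have := mem_one_all_park _ y0 pos hpark.
rewrite size_map !size_tuple => /(_ erefl) x1.
rewrite deg_count -[X in _ < X](size_tuple x) -(size_map val).
by rewrite -(count_predC (predC1 1)) -[X in X < _]addn0 ltn_add2l -has_count;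
   apply/hasP; exists 1.
Qed.

(** Here [k.+1] is the least preference other than 1. Placing the 1 first bounds the first length
    below by [k]; placing [k.+1] first and the 1 on a later car forces that car's length to be
    [k]. *)
Lemma deg_pred_lengths n (y : n.-tuple nat) (x : preferences y) :
  1 < n -> (forall i, 0 < tnth y i) -> x \in PAinv y -> deg x = n.-1 ->
  exists k, k <= nth 0 y 0 /\ forall i, 0 < i < n -> nth 0 y i = k.
Proof.
move=> n1 hy hx hdeg.
have sz : size (map val x) = n by rewrite size_map size_tuple.
have [pos _] := andP (PAinv_all_park hx (perm_refl _)).
have [r er] : exists r, perm_eq (map val x) (1 :: r).
  exists (rem 1 (map val x)); apply: perm_to_rem.
  rewrite -has_pred1 has_count.
  by have := count_predC (predC1 1) (map val x); rewrite sz -deg_count hdeg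
       (eq_count (a2 := pred1 1)) => [|j /=]; [lia | rewrite negbK].
have szr : size r = n.-1 by rewrite -sz (perm_size er).
have r1 : all (leq 2) r.
  have := hdeg; rewrite deg_count (permP er) /= add0n -szr => /eqP.
  rewrite -all_count => /allP rn1; apply/allP=> j j_r.
  move: pos; rewrite (perm_all _ er) => /= /allP/(_ _ j_r).
  by have := rn1 _ j_r; rewrite /=; lia.
(* Sorting [r], which is nonempty as [1 < n], exposes its least entry. *)
have [k [r' [k0 hk er']]] :
    exists k r', [/\ 0 < k, all (leq k.+1) (k.+1 :: r') & perm_eq r (k.+1 :: r')].
  have := sort_sorted leq_total r; have := permEl (perm_sort leq r).
  case: sort => [|w r'] hw.
    by have := perm_size hw; rewrite szr /=; lia.
  move=> hsorted; have : 1 < w by apply: (allP r1); rewrite -(perm_mem hw) mem_head.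
  case: w => [|k] // in hw hsorted * => k0; exists k, r'; split=> //.
    by rewrite /= leqnn; exact: order_path_min leq_trans hsorted.
  by rewrite perm_sym.
have szr' : (size r').+1 = n.-1 by rewrite -szr (perm_size er').
have hperm : perm_eq (map val x) (1 :: k.+1 :: r').
  by rewrite (permPl er) perm_cons.
have km : k <= sumn y.
  have : k.+1 \in map val x by rewrite (perm_mem hperm) !inE eqxx orbT.
  case/mapP=> j _ ek; rewrite -street_length_sumn -ltnS ltnW // [X in X < _]ek.
  exact: ltn_ord.
move: hk; rewrite /= leqnn /= => hk.
have park s : perm_eq s (1 :: k.+1 :: r') -> all_park (sumn y) [::] (zip s y).
  by rewrite -(permPr hperm) => /(PAinv_all_park hx)/andP[].
have y00 : 0 < nth 0 y 0 by have := hy (Ordinal (ltnW n1)); rewrite (tnth_nth 0).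
exists k; have := size_tuple y; move: km park y00.
case: (tval y) => [|y0 ys] km park /= y00 szy; first lia.
split.
  have := park _ (perm_refl _).
  by apply: (@one_car_length_ge k [::] (k.+1 :: r') [::] ys);
    rewrite //= ?leqnn //; lia.
case=> [//|i] /= hi.
have i_ys : i < size ys by lia.
have i_r' : i <= size r' by lia.
have eys : ys = take i ys ++ nth 0 ys i :: drop i.+1 ys.
  by rewrite -drop_nth // cat_take_drop.
(* This single arrangement yields both inequalities for the length [nth 0 ys i]. *)
have hpark : all_park (sumn (y0 :: ys)) [::]
    (zip (k.+1 :: take i r' ++ 1 :: drop i r') (y0 :: ys)).
  apply: park; have := permEl (perm_catCA (k.+1 :: take i r') [:: 1] (drop i r')).
  by rewrite /= cat_take_drop.
have s1 : size (take i r') = size (take i ys) by rewrite !size_takel //; lia.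
have s2 : size (drop i r') = size (drop i.+1 ys) by rewrite !size_drop; lia.
rewrite eys in km hpark.
have hk' : all (leq k.+1) (take i r' ++ drop i r') by rewrite cat_take_drop.
apply/eqP; rewrite eqn_leq; apply/andP; split.
  exact: one_car_length_le hpark.
apply: (@one_car_length_ge k (k.+1 :: take i r') (drop i r')
  (y0 :: take i ys) (drop i.+1 ys)) => //=; first by rewrite s1.
by rewrite leqnn.
Qed.

(** * The witness of degree [n.-1] and the equivalence *)

Lemma PAinv_two_values n (y : n.-tuple nat) b :
  1 < n -> 0 < b <= nth 0 y 0 -> (forall i, 0 < i < n -> nth 0 y i = b) ->
  exists2 x, x \in PAinv y & deg x = n.-1.
Proof.
move=> n1 /andP[b0 hb] hyb.
have ey : tval y = nth 0 y 0 :: nseq n.-1 b.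
  apply: (@eq_from_nth _ 0); first by rewrite size_tuple /= size_nseq; lia.
  rewrite size_tuple => -[//|i] hi /=.
  by rewrite nth_nseq hyb //; case: ltnP => //; lia.
have ysum : sumn y = nth 0 y 0 + n.-1 * b by rewrite ey /= sumn_nseq mulnC.
(* Two cars of length at least [b] give [b.+1 <= 2 * b <= street_length y], so [inord] preserves the
   entries of the witness. *)
have bm : b.+1 < (street_length y).+1 by rewrite street_length_sumn ysum; nia.
have m1 : 1 < (street_length y).+1 by lia.
have szs : size (1 :: nseq n.-1 b.+1) == n by rewrite /= size_nseq; lia.
pose x : preferences y := map_tuple inord (Tuple szs).
have ex : map val x = 1 :: nseq n.-1 b.+1.
  by rewrite /= map_nseq map_nseq /= !inordK.
have hin (x' : preferences y) : perm_eq x' x -> x' \in PA y.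
  move=> /(perm_map val); rewrite ex inE => hperm.
  have hall : all [pred x | (x == 1) || (x == b.+1)] (map val x').
    by rewrite (perm_all _ hperm) /= all_nseq /= eqxx !orbT.
  have hcount : count_mem 1 (map val x') = 1.
    by rewrite (permP hperm) /= count_nseq /= eqSS -[b == 0]negbK -lt0n b0 mul0n.
  have szx : size (map val x') = n by rewrite size_map size_tuple.
  apply/andP; split.
    apply/forallP=> i; have /allP := hall.
    by move=> /(_ _ (map_f val (mem_tnth i x'))) /=; lia.
  have hm : street_length y = nth 0 y 0 + (size (map val x')).-1 * b.
    by rewrite szx street_length_sumn ysum.
  have -> : tval y = nth 0 y 0 :: nseq (size (map val x')).-1 b by rewrite szx.
  move: hm hall hcount; move: (map val x') => xs -> hall hcount.
  by apply: all_park_two_values_first; rewrite ?b0.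
exists x.
  by rewrite inE hin //; apply/forallP=> x'; apply/implyP=> /hin.
rewrite deg_count ex /= count_nseq /= eqSS -lt0n b0 mul1n.
by [].
Qed.

Theorem theorem2 (n : nat) (hn : 2 <= n) (y : n.-tuple nat)
    (hy : forall i : 'I_n, 0 < tnth y i) :
  chi y = n.-1 <->
  (nth 0 y 1 <= nth 0 y 0 /\
   forall i : nat, 1 <= i < n -> nth 0 y i = nth 0 y 1).
Proof.
have y_gt0 i : i < n -> 0 < nth 0 y i.
  by move=> hi; have := hy (Ordinal hi); rewrite (tnth_nth 0).
have sumn_gt0 : 0 < sumn y.
  have := y_gt0 0 (ltnW hn); case: (tval y) => //= y0 ys; lia.
split=> [hchi|[h01 hyb]].
  (* The maximum is attained unless [PAinv y] is empty; its default 0 would then contradict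
     [n.-1 > 0]. *)
  case: (posnP #|PAinv y|) => [e0|/(eq_bigmax_cond (@deg n y))[x hx hdeg]].
    by move: hchi; rewrite /chi big_pred0; [lia | exact: card0_eq].
  have hdeg' : deg x = n.-1 by rewrite -hdeg.
  have [k [hk hyk]] := deg_pred_lengths hn hy hx hdeg'.
  by split=> [|i /hyk ->]; rewrite hyk //; exact: hn.
have hb : 0 < nth 0 y 1 <= nth 0 y 0 by rewrite y_gt0.
have [x hx hdeg] := PAinv_two_values hn hb hyb.
apply/eqP; rewrite eqn_leq; apply/andP; split.
  by apply/bigmax_leqP=> z /(deg_lt sumn_gt0); lia.
by rewrite -hdeg; apply: (leq_bigmax_cond x hx).
Qed.
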